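(* Let $G$ be a connected graph with $n\geq 12$ vertices. If $\frac{1}{2}\leq \alpha < 1$, then $$S_{2}(A_{\alpha}(G))\geq S_{2}(A_{\alpha}(P_n)),$$ with equality if and only if $G=P_n$.
   Context: All graphs are simple and undirected. $P_n$ is the path on $n$ vertices. $A_{\alpha}(G)=\alpha D(G)+(1-\alpha)A(G)$, where $A(G)$ is the adjacency matrix and $D(G)$ the diagonal degree matrix. For a real symmetric matrix $M$ with eigenvalues $\lambda_1(M)\geq\cdots\geq\lambda_n(M)$, $S_2(M)=\lambda_1(M)+\lambda_2(M)$. *)

(* Defs.v *)
From HB Require Import structures.
From mathcomp Require Import all_boot all_order all_algebra perm.
From mathcomp Require Import reals.
From Stdlib Require Import ClassicalEpsilon.
Set Implicit Arguments. Unset Strict Implicit. Unset Printing Implicit Defensive.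
Import Order.TTheory GRing.Theory Num.Theory.
Local Open Scope ring_scope.

Definition simple_graph (n : nat) (e : rel 'I_n) : Prop :=
  symmetric e /\ irreflexive e.

Definition graph_connected (n : nat) (e : rel 'I_n) : Prop :=
  forall x y : 'I_n, connect e x y.

Definition path_graph (n : nat) : rel 'I_n :=
  fun i j => (i.+1 == j :> nat) || (j.+1 == i :> nat).

Definition graph_iso (n : nat) (e1 e2 : rel 'I_n) : Prop :=
  exists f : {perm 'I_n}, forall x y : 'I_n, e1 x y = e2 (f x) (f y).

Definition adj_mx (R : realType) (n : nat) (e : rel 'I_n) : 'M[R]_n :=
  \matrix_(i, j) (e i j)%:R.

Definition deg_mx (R : realType) (n : nat) (e : rel 'I_n) : 'M[R]_n :=
  \matrix_(i, j) ((i == j)%:R * (#|[set k | e i k]|)%:R).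

Definition A_alpha (R : realType) (n : nat) (alpha : R) (e : rel 'I_n) : 'M[R]_n :=
  alpha *: deg_mx R e + (1 - alpha) *: adj_mx R e.

(* The eigenvalues of M, listed with multiplicity in non-increasing order:
   a non-increasing sequence s with char_poly M = prod_(x <- s) (X - x).
   (For a real symmetric matrix such s exists and is unique.) *)
Definition is_eig_list (R : realType) (n : nat) (M : 'M[R]_n) (s : seq R) : Prop :=
  sorted (fun x y : R => y <= x) s /\
  char_poly M = \prod_(x <- s) ('X - x%:P).

Definition eigs (R : realType) (n : nat) (M : 'M[R]_n) : seq R :=
  epsilon (inhabits [::]) (is_eig_list M).

Definition S2 (R : realType) (n : nat) (M : 'M[R]_n) : R :=
  (eigs M)`_0 + (eigs M)`_1.

(* Main.v *)
(** For [x : 'rV_n] the quadratic form of [A_alpha] is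
    [(2 alpha - 1) x D x^T + (1 - alpha) x Q x^T] with [Q = D + A] the signless
    Laplacian, and it is monotone in the edge set because [alpha >= 1/2].
    Both leading eigenvalues of the path are smaller than 2, so [S2] is below 4
    there.  If [G] has a vertex of degree at least 3, then [S2 >= 4] by Ky Fan's
    inequality: it suffices to find, on some subtree of [G], orthogonal vectors
    on which [D] has trace at least 4 and [Q] trace at least 8.  Growing a
    subtree breadth first from a claw, such vectors exist at the latest when it
    has 12 vertices, which is a finite computation.  Otherwise [G] has a
    Hamiltonian path; an edge outside this path makes the Rayleigh quotient of the
    all-ones vector at least 2, and this vector together with one orthogonal to
    it, taken from the span of the two leading eigenvectors of the path, proves
    strictness. *)
Require Import Defs.
From Stdlib Require Import ZArith.
From HB Require Import structures.
From mathcomp Require Import all_boot all_order all_algebra perm.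
From mathcomp Require Import reals.
From mathcomp Require Import sesquilinear spectral complex lra ring zify ssrZ.
From Stdlib Require Import Classical ClassicalEpsilon.
Import Order.TTheory GRing.Theory Num.Theory.
Local Open Scope ring_scope.
Set Implicit Arguments. Unset Strict Implicit. Unset Printing Implicit Defensive.

(** * Real symmetric matrices *)

(** Over [F[i]] the matrix is Hermitian, so its spectral diagonal is real; [eigenvalue_map] brings
    such an eigenvalue, and with it an eigenvector, back to [F]. *)
Lemma symmetric_eigenvector (F : rcfType) n (M : 'M[F]_n.+1) :
  M^T = M -> exists a, exists2 v : 'rV_n.+1, v *m M = a *: v & v != 0.
Proof.
move=> symM; pose h := [the {rmorphism F -> F[i]} of real_complex F].
pose A := map_mx h M.
have hermA : A \is hermsymmx.
  apply: realsym_hermsym.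
    by apply/is_hermitianmxP; rewrite expr0 scale1r map_mx_id // map_trmx symM.
  by apply/mxOverP => i j; rewrite mxE complex_real.
have /mxOverP/(_ 0 0)/complex_realP [r dr] := hermitian_spectral_diag_real hermA.
have AE := orthomx_spectralP (hermitian_normalmx hermA).
have unitP := spectral_unit A.
exists r; apply/eigenvalueP; rewrite -(eigenvalue_map h).
apply/eigenvalueP; exists (row 0 (spectralmx A)).
  rewrite -/A [in X in _ *m X]AE -row_mul !mulmxA mulmxV // mul1mx row_mul.
  by rewrite row_diag_mx -scalemxAl -rowE dr.
apply/eqP => P0; move: unitP; rewrite -row_free_unit => /row_freeP[B PB].
have := congr1 (fun X => row 0 X) PB; rewrite row_mul P0 mul0mx => /rowP/(_ 0).
by rewrite !mxE eqxx => /esym/eqP; rewrite oner_eq0.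
Qed.

Definition dotr (F : pzRingType) n (x y : 'rV[F]_n) : F := (x *m y^T) 0 0.

Lemma dotrE (F : pzRingType) n (x y : 'rV[F]_n) :
  dotr x y = \sum_i x 0 i * y 0 i.
Proof. by rewrite /dotr mxE; apply: eq_bigr => i _; rewrite mxE. Qed.

Lemma dotrC (F : comPzRingType) n (x y : 'rV[F]_n) : dotr x y = dotr y x.
Proof. by rewrite !dotrE; apply: eq_bigr => i _; rewrite mulrC. Qed.

Lemma dotrDl (F : pzRingType) n (x y z : 'rV[F]_n) :
  dotr (x + y) z = dotr x z + dotr y z.
Proof. by rewrite /dotr mulmxDl mxE. Qed.

Lemma dotrBl (F : pzRingType) n (x y z : 'rV[F]_n) :
  dotr (x - y) z = dotr x z - dotr y z.
Proof. by rewrite /dotr mulmxBl !mxE. Qed.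

Lemma dotrZl (F : pzRingType) n a (x y : 'rV[F]_n) :
  dotr (a *: x) y = a * dotr x y.
Proof. by rewrite /dotr -scalemxAl mxE. Qed.

Lemma dotrDr (F : comPzRingType) n (x y z : 'rV[F]_n) :
  dotr z (x + y) = dotr z x + dotr z y.
Proof. by rewrite dotrC dotrDl !(dotrC z). Qed.

Lemma dotrBr (F : comPzRingType) n (x y z : 'rV[F]_n) :
  dotr z (x - y) = dotr z x - dotr z y.
Proof. by rewrite dotrC dotrBl !(dotrC z). Qed.

Lemma dotrZr (F : comPzRingType) n a (x y : 'rV[F]_n) :
  dotr x (a *: y) = a * dotr x y.
Proof. by rewrite dotrC dotrZl dotrC. Qed.

Lemma mulmx_tr_dotr (F : pzRingType) n (x y : 'rV[F]_n) :
  x *m y^T = (dotr x y)%:M.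
Proof. exact: mx11_scalar. Qed.

Lemma dotrr_gt0 (F : realDomainType) n (x : 'rV[F]_n) :
  (0 < dotr x x) = (x != 0).
Proof.
have sq_ge0 i : true -> 0 <= x 0 i * x 0 i by rewrite -expr2 sqr_ge0.
rewrite dotrE lt_def sumr_ge0 // andbT psumr_eq0 //; congr (~~ _).
apply/allP/eqP => [x0|x0 i _]; last by rewrite x0 mxE mulr0 eqxx.
apply/rowP => i; rewrite mxE; apply/eqP.
by have := x0 i (mem_index_enum _); rewrite /= mulf_eq0 orbb.
Qed.

(* The Householder reflection exchanging [v] and the first basis vector. *)
Lemma orthogonal_first_row (F : rcfType) n (v : 'rV[F]_n.+1) :
  dotr v v = 1 -> exists H : 'M[F]_n.+1,
    [/\ H^T = H, H *m H = 1%:M & row 0 H = v].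
Proof.
move=> v1; pose e : 'rV[F]_n.+1 := delta_mx 0 0; pose w := v - e.
have [w0|w0] := eqVneq w 0.
  exists 1%:M; rewrite trmx1 mul1mx; split=> //.
  by rewrite row1; apply/esym/subr0_eq.
have ev : dotr e v = v 0 0.
  rewrite dotrE (bigD1 0) //= big1 => [|i /negPf i0];
    by rewrite !mxE ?i0 ?eqxx ?mul0r ?mul1r ?addr0.
have ee : dotr e e = 1 by rewrite /dotr /e trmx_delta mul_delta_mx mxE eqxx.
have ew : dotr e w = v 0 0 - 1 by rewrite dotrBr ev ee.
have ww : dotr w w = 2 * (1 - v 0 0).
  by rewrite {1}/w dotrBl ew dotrBr v1 dotrC ev; ring.
have ww0 : dotr w w != 0 by rewrite gt_eqF // dotrr_gt0.
pose c := 2 / dotr w w; pose K := w^T *m w.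
have KK : K *m K = dotr w w *: K.
  by rewrite /K mulmxA -(mulmxA _ w) mulmx_tr_dotr -mulmxA mul_scalar_mx scalemxAr.
exists (1%:M - c *: K); split.
- by rewrite linearB linearZ /= trmx1 trmx_mul trmxK.
- rewrite mulmxBl mul1mx mulmxBr mulmx1 -scalemxAr -scalemxAl scalerA KK scalerA.
  have -> : c * c * dotr w w = c + c by rewrite /c; field.
  by rewrite scalerDl; move: (c *: K) => X; apply/matrixP => i j; rewrite !mxE; ring.
- rewrite rowE mulmxBr mulmx1 -scalemxAr mulmxA mulmx_tr_dotr -/e ew.
  rewrite mul_scalar_mx scalerA.
  (* As [dotr w w = 2 (1 - v_0)], the first basis vector is sent to itself plus [w], which is
     [v]. *)
  have -> : c * (v 0 0 - 1) = -1.
    have : 1 - v 0 0 != 0 by move: ww0; rewrite ww mulf_eq0 negb_or => /andP[].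
    by rewrite /c ww => h; field.
  by rewrite scaleN1r opprK addrC subrK.
Qed.

(** Deflation: conjugation by a reflection whose first row is a unit eigenvector makes the first row
    a multiple of the first basis vector, symmetry clears the first column, and induction treats the
    remaining block. *)
Theorem symmetric_spectral (F : rcfType) n (M : 'M[F]_n) : M^T = M ->
  exists P : 'M[F]_n, exists2 d : 'rV_n,
    P *m P^T = 1%:M & M = P^T *m diag_mx d *m P.
Proof.
elim: n M => [|n IH] M symM.
  by exists 1%:M, 0; [apply/matrixP => -[] | apply/matrixP => -[]].
have [a [v0 v0M v00]] := symmetric_eigenvector symM.
pose v := (Num.sqrt (dotr v0 v0))^-1 *: v0.
have vv : dotr v v = 1.
  have := v00; rewrite -dotrr_gt0 => /[dup] /gt_eqF v0n /ltW v0p.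
  rewrite dotrZl dotrZr mulrA -invfM -expr2 sqr_sqrtr //.
  by rewrite mulVf ?v0n.
have vM : v *m M = a *: v by rewrite /v -scalemxAl v0M !scalerA mulrC.
have [H [symH HH H0]] := orthogonal_first_row vv.
pose N : 'M[F]_(1 + n) := H *m M *m H.
have symN : N^T = N by rewrite /N !trmx_mul symH symM mulmxA.
have N0 : row 0 N = a *: delta_mx 0 0.
  by rewrite !row_mul H0 vM -scalemxAl -H0 -row_mul HH row1.
have Nu : usubmx N = a *: delta_mx 0 0.
  rewrite -N0; apply/matrixP => i j; rewrite [LHS]mxE [RHS]mxE ord1.
  by congr (N _ _); apply: val_inj.
have ur0 : ursubmx N = 0.
  rewrite /ursubmx Nu; apply/matrixP => i j; rewrite !mxE !ord1 andbC.
  by case: eqP => //; rewrite mulr0.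
have dl0 : dlsubmx N = 0 by rewrite -[dlsubmx N]trmxK trmx_dlsub symN ur0 trmx0.
have ul0 : ulsubmx N = a%:M.
  by rewrite /ulsubmx Nu; apply/matrixP => i j; rewrite !ord1 !mxE eqxx mulr1.
have symN' : (drsubmx N)^T = drsubmx N by rewrite trmx_drsub symN.
have [P [d PP NP]] := IH _ symN'.
pose B : 'M[F]_(1 + n) := block_mx 1%:M 0 0 P.
pose D : 'rV[F]_(1 + n) := row_mx a%:M d.
have BB : B *m B^T = 1%:M.
  rewrite tr_block_mx !trmx0 trmx1 mulmx_block !mulmx0 !mul0mx mulmx1.
  by rewrite !addr0 add0r PP -scalar_mx_block.
have NB : N = B^T *m diag_mx D *m B.
  rewrite -[N]submxK ul0 ur0 dl0 NP tr_block_mx !trmx0 trmx1 diag_mx_row.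
  rewrite !mulmx_block !mulmx0 !mul0mx !mulmx1 !mul1mx !addr0 !add0r.
  congr block_mx; last by rewrite mul0mx.
  by apply/matrixP => i j; rewrite !ord1 !mxE eqxx.
exists (B *m H), D.
  by rewrite trmx_mul symH mulmxA -(mulmxA B) HH mulmx1.
have -> : M = H *m N *m H by rewrite /N !mulmxA HH mul1mx -mulmxA HH mulmx1.
by rewrite NB trmx_mul symH !mulmxA.
Qed.

Lemma char_poly_conj (F : comNzRingType) n (P Q A : 'M[F]_n) :
  P *m Q = 1%:M -> char_poly (Q *m A *m P) = char_poly A.
Proof.
move=> PQ; have QP := mulmx1C PQ.
have PQ' : map_mx polyC P *m map_mx polyC Q = 1%:M by rewrite -map_mxM PQ map_mx1.
have QP' : map_mx polyC Q *m map_mx polyC P = 1%:M by rewrite -map_mxM QP map_mx1.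
have -> : char_poly (Q *m A *m P)
    = \det (map_mx polyC Q *m char_poly_mx A *m map_mx polyC P).
  congr (\det _); rewrite /char_poly_mx mulmxBr mulmxBl !map_mxM /=.
  by rewrite scalar_mxC -!mulmxA QP' mulmx1.
by rewrite !det_mulmx mulrAC -det_mulmx QP' det1 mul1r.
Qed.

(** Sorting the diagonal of a spectral decomposition shows that the specification behind [epsilon]
    is satisfiable. Unique factorisation makes [eigs M] a permutation of that diagonal, and
    permuting the rows of [P] alike preserves the decomposition. *)
Lemma eigs_spectral (R : realType) n (M : 'M[R]_n) : M^T = M ->
  exists P : 'M[R]_n,
    [/\ P *m P^T = 1%:M, size (eigs M) = n,
        sorted (fun x y : R => y <= x) (eigs M)
      & M = P^T *m diag_mx (\row_i (eigs M)`_i) *m P].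
Proof.
move=> /symmetric_spectral[P [d PP MP]].
have charM : char_poly M = \prod_(x <- codom (d 0)) ('X - x%:P).
  rewrite MP char_poly_conj // char_poly_trig ?diag_mx_is_trig // big_image /=.
  by apply: eq_bigr => i _; rewrite mxE eqxx.
have ge_total : total (fun x y : R => y <= x) by move=> x y; apply: le_total.
have [sortedE charE] : is_eig_list M (eigs M).
  apply: epsilon_spec; exists (sort (fun x y : R => y <= x) (codom (d 0))).
  split; first exact: sort_sorted.
  by rewrite charM; apply: perm_big; rewrite perm_sym perm_sort.
have perm_d : perm_eq (eigs M) (codom (d 0)).
  by apply: prod_XsubC_eq; rewrite -charE -charM.
have sizeE : size (eigs M) = n by rewrite (perm_size perm_d) size_codom card_ord.
have /tuple_permP[s sE] : perm_eq (eigs M) [tuple d 0 i | i < n].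
  by apply: perm_trans perm_d _; rewrite /= -codomE.
exists (row_perm s P); split => //.
  apply/matrixP => i j; have /matrixP/(_ (s i) (s j)) := PP.
  rewrite !mxE (inj_eq perm_inj) => <-.
  by apply: eq_bigr => k _; rewrite !mxE.
rewrite [LHS]MP; apply/matrixP => i j; rewrite !mul_mx_diag !mxE.
rewrite (reindex_inj (@perm_inj _ s)); apply: eq_bigr => k _; rewrite !mxE sE.
by rewrite (nth_map k) ?size_enum_ord // nth_ord_enum !tnth_map ?tnth_ord_tuple.
Qed.

Lemma sorted_nth_ge (F : realDomainType) (s : seq F) i j :
  sorted (fun x y : F => y <= x) s -> (i <= j < size s)%N -> s`_j <= s`_i.
Proof.
move=> sorted_s /andP[ij js].
have tr : transitive (fun x y : F => y <= x).
  by move=> y x z yx zy; apply: le_trans zy yx.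
apply: (sorted_leq_nth tr _ _ sorted_s) => //; rewrite ?inE //.
exact: leq_ltn_trans js.
Qed.

(** * Variational bounds for the two leading eigenvalues *)

Lemma dotr_orthogonal (F : comPzRingType) n (P : 'M[F]_n) (x y : 'rV[F]_n) :
  P *m P^T = 1%:M -> dotr (x *m P) (y *m P) = dotr x y.
Proof. by move=> PP; rewrite /dotr trmx_mul mulmxA -(mulmxA x) PP mulmx1. Qed.

Lemma dotr_delta (F : pzRingType) n (x : 'rV[F]_n) i : dotr x (delta_mx 0 i) = x 0 i.
Proof.
rewrite dotrE (bigD1 i) //= big1 => [|j /negPf ji]; rewrite mxE ?ji ?eqxx ?mulr0 //.
by rewrite addr0 mulr1.
Qed.

(** The basis vector [e] minus its projection to the span of [u] and [v] has squared norm
    [1 - u_i^2 - v_i^2]. *)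
Lemma bessel2 (F : realDomainType) n (u v : 'rV[F]_n) i :
  dotr u u = 1 -> dotr v v = 1 -> dotr u v = 0 -> u 0 i ^+ 2 + v 0 i ^+ 2 <= 1.
Proof.
move=> u1 v1 uv; pose e : 'rV[F]_n := delta_mx 0 i.
have ee : dotr e e = 1 by rewrite dotr_delta mxE !eqxx.
have : 0 <= dotr (e - u 0 i *: u - v 0 i *: v) (e - u 0 i *: u - v 0 i *: v).
  by rewrite dotrE sumr_ge0 // => j _; rewrite -expr2 sqr_ge0.
rewrite !(dotrBl, dotrBr, dotrZl, dotrZr) u1 v1 ee (dotrC v u) uv.
rewrite !(dotrC e) !dotr_delta => h; rewrite -subr_ge0; apply: le_trans h _.
by rewrite le_eqVlt; apply/orP; left; apply/eqP; ring.
Qed.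

Section SymmetricMatrix.
Variables (R : realType) (n : nat) (M : 'M[R]_n.+2).
Hypothesis symM : M^T = M.

(** In eigenbasis coordinates the weights [u_i^2 + v_i^2] sum to 2, and Bessel bounds the first one
    by 1. With [s_1] subtracted from all eigenvalues, only the first term can be positive, and it is
    at most [s_0 - s_1]. *)
Theorem ky_fan2 (x y : 'rV[R]_n.+2) :
  dotr x x = 1 -> dotr y y = 1 -> dotr x y = 0 ->
  dotr (x *m M) x + dotr (y *m M) y <= S2 M.
Proof.
move=> x1 y1 xy; have [P [PP sizeE sortE ME]] := eigs_spectral symM.
have formE z : dotr (z *m M) z = \sum_(i < n.+2) (eigs M)`_i * (z *m P^T) 0 i ^+ 2.
  have zP : P *m z^T = (z *m P^T)^T by rewrite trmx_mul trmxK.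
  rewrite {1}ME /dotr -!mulmxA zP !mulmxA -/(dotr _ (z *m P^T)) dotrE.
  apply: eq_bigr => i _.
  by rewrite mul_mx_diag [X in X * _]mxE [X in _ * X * _]mxE; ring.
have tr_orth : P^T *m P^T^T = 1%:M by rewrite trmxK (mulmx1C PP).
set u := x *m P^T in formE *.
have u1 : dotr u u = 1 by rewrite dotr_orthogonal.
pose v := y *m P^T; have v1 : dotr v v = 1 by rewrite dotr_orthogonal.
have uv : dotr u v = 0 by rewrite dotr_orthogonal.
rewrite !formE -/u -/v -big_split /= /S2.
set s := eigs M in sizeE sortE *.
have s_le i : (0 < i < n.+2)%N -> s`_i <= s`_1.
  by move=> iP; apply: sorted_nth_ge => //; rewrite sizeE.
have s10 : s`_1 <= s`_0 by apply: sorted_nth_ge => //; rewrite sizeE.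
have -> : \sum_(i < n.+2) (s`_i * u 0 i ^+ 2 + s`_i * v 0 i ^+ 2)
    = \sum_(i < n.+2) (s`_i - s`_1) * (u 0 i ^+ 2 + v 0 i ^+ 2)
      + s`_1 * (dotr u u + dotr v v).
  rewrite !dotrE -big_split /= mulr_sumr -big_split /=.
  by apply: eq_bigr => i _; ring.
rewrite u1 v1 big_ord_recl /=.
have w0 := bessel2 ord0 u1 v1 uv.
have : (s`_0 - s`_1) * (u 0 ord0 ^+ 2 + v 0 ord0 ^+ 2) <= s`_0 - s`_1.
  by rewrite ler_piMr // subr_ge0.
have : \sum_(i < n.+1) (s`_(lift ord0 i) - s`_1) *
    (u 0 (lift ord0 i) ^+ 2 + v 0 (lift ord0 i) ^+ 2) <= 0.
  apply: sumr_le0 => i _; rewrite mulr_le0_ge0 ?addr_ge0 ?sqr_ge0 // subr_le0.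
  by rewrite s_le //= /bump leq0n add1n ltnS ltn_ord.
by lra.
Qed.

Lemma eigs_eigenvector i : (i < n.+2)%N ->
  exists2 v : 'rV[R]_n.+2, v *m M = (eigs M)`_i *: v & v != 0.
Proof.
move=> ltin; have [P [PP sizeE sortE ME]] := eigs_spectral symM.
pose j := Ordinal ltin; exists (row j P).
  rewrite {1}ME !mulmxA -row_mul PP row1.
  have -> : delta_mx 0 j *m diag_mx (\row_i (eigs M)`_i)
      = (eigs M)`_j *: delta_mx 0 j :> 'rV_n.+2.
    by rewrite -rowE row_diag_mx mxE.
  by rewrite -scalemxAl -rowE.
by rewrite -dotrr_gt0 !rowE dotr_orthogonal // dotr_delta mxE !eqxx ltr01.
Qed.

(** The span of two leading eigenvectors has dimension 2, so it contains a nonzero vector orthogonal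
    to [w]; on this span the Rayleigh quotient is at least the second eigenvalue. *)
Lemma courant_fischer2 (w : 'rV[R]_n.+2) :
  exists2 u : 'rV[R]_n.+2, u != 0 /\ dotr u w = 0
                       & (eigs M)`_1 * dotr u u <= dotr (u *m M) u.
Proof.
have [P [PP sizeE sortE ME]] := eigs_spectral symM.
have [a [b [ab abw]]] : exists a b, 0 < a ^+ 2 + b ^+ 2 /\
    a * dotr (row 0 P) w + b * dotr (row 1 P) w = 0.
  have [w0|w0] := eqVneq (dotr (row 0 P) w) 0.
    by exists 1, 0; rewrite w0; split; [rewrite expr1n expr0n addr0 | ring].
  exists (dotr (row 1 P) w), (- dotr (row 0 P) w); split; last by ring.
  by rewrite ltr_wpDl ?sqr_ge0 // sqrrN exprn_even_gt0.
pose e : 'rV[R]_n.+2 := a *: delta_mx 0 0 + b *: delta_mx 0 1.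
have eM : e *m P *m M
    = ((eigs M)`_0 * a *: delta_mx 0 0 + (eigs M)`_1 * b *: delta_mx 0 1) *m P.
  rewrite {1}ME !mulmxA -[_ *m P *m _]mulmxA PP mulmx1; congr (_ *m _).
  rewrite mulmxDl -!scalemxAl -!rowE !row_diag_mx !mxE !scalerA.
  by rewrite !(mulrC (_`_ _)).
have ee : dotr e e = a ^+ 2 + b ^+ 2.
  by rewrite dotrDr !dotrZr !dotr_delta !mxE !eqxx /=; ring.
exists (e *m P); first split.
- by rewrite -dotrr_gt0 dotr_orthogonal // ee.
- by rewrite mulmxDl -!scalemxAl -!rowE dotrDl !dotrZl.
rewrite eM !dotr_orthogonal // ee dotrDr !dotrZr !dotr_delta !mxE !eqxx /=.
have : (eigs M)`_1 <= (eigs M)`_0 by apply: sorted_nth_ge => //; rewrite sizeE.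
by rewrite -subr_ge0 => /(mulr_ge0 (sqr_ge0 a)); lra.
Qed.

End SymmetricMatrix.

(** * The quadratic form of [A_alpha] *)

Section AlphaForm.
Variables (R : realType) (n : nat) (alpha : R) (e : rel 'I_n).
Implicit Types x : 'rV[R]_n.

Lemma A_alpha_form x : dotr (x *m A_alpha alpha e) x =
  \sum_i \sum_j (e i j)%:R * (alpha * x 0 i ^+ 2 + (1 - alpha) * (x 0 i * x 0 j)).
Proof.
rewrite dotrE; under eq_bigr do rewrite mxE mulr_suml; rewrite exchange_big /=.
apply: eq_bigr => i _; under eq_bigr do rewrite !mxE.
under [RHS]eq_bigr do rewrite mulrDr; rewrite big_split /=.
under eq_bigr do rewrite mulrDr mulrDl; rewrite big_split /=; congr (_ + _); last first.
  by apply: eq_bigr => j _; ring.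
rewrite (bigD1 i) //= big1 => [|j /negPf ji]; last by rewrite (eq_sym i) ji mulr0n; ring.
rewrite -mulr_suml eqxx mulr1n -sum1_card natr_sum big_mkcond /=.
have -> : \sum_j (if j \in [set k | e i k] then 1 else 0) = \sum_j (e i j)%:R :> R.
  by apply: eq_bigr => j _; rewrite inE; case: (e i j).
ring.
Qed.

(** Contribution to the quadratic form of one undirected edge whose ends carry the values [a] and
    [b]. *)
Definition edge_form (a b : R) : R :=
  alpha * (a ^+ 2 + b ^+ 2) + 2 * (1 - alpha) * (a * b).

Hypothesis sym_e : symmetric e.

Lemma A_alpha_sym : (A_alpha alpha e)^T = A_alpha alpha e.
Proof.
apply/matrixP => i j; rewrite !mxE sym_e eq_sym; congr (_ * _ + _).
by have [->|] := eqVneq i j; rewrite ?mul0r.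
Qed.

(** The double sum meets each edge in both orientations, whence the factor 2. *)
Lemma A_alpha_edge_form x : 2 * dotr (x *m A_alpha alpha e) x =
  \sum_i \sum_j (e i j)%:R * edge_form (x 0 i) (x 0 j).
Proof.
rewrite A_alpha_form mulr2n mulrDl !mul1r.
rewrite [X in _ + X]exchange_big -big_split; apply: eq_bigr => i _ /=.
rewrite -big_split; apply: eq_bigr => j _ /=.
by rewrite (sym_e j i) /edge_form; ring.
Qed.

Hypotheses (alpha_ge : 1 / 2 <= alpha) (alpha_lt1 : alpha < 1).

(** The bounds on [alpha] make both coefficients nonnegative once the form is split into a degree
    part and a signless Laplacian part. *)
Lemma edge_form_ge0 a b : 0 <= edge_form a b.
Proof.
have -> : edge_form a b
    = (2 * alpha - 1) * (a ^+ 2 + b ^+ 2) + (1 - alpha) * (a + b) ^+ 2.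
  by rewrite /edge_form; ring.
have h1 : 0 <= 2 * alpha - 1 by move: alpha_ge; lra.
have h2 : 0 <= 1 - alpha by rewrite subr_ge0 ltW.
exact: addr_ge0 (mulr_ge0 h1 (addr_ge0 (sqr_ge0 _) (sqr_ge0 _))) (mulr_ge0 h2 (sqr_ge0 _)).
Qed.

End AlphaForm.

Lemma A_alpha_form_mono (R : realType) n (alpha : R) (e1 e2 : rel 'I_n) (x : 'rV[R]_n) :
  1 / 2 <= alpha -> alpha < 1 -> symmetric e1 -> symmetric e2 -> subrel e1 e2 ->
  dotr (x *m A_alpha alpha e1) x <= dotr (x *m A_alpha alpha e2) x.
Proof.
move=> a1 a2 sym1 sym2 sub12; rewrite -(ler_pM2l (ltr0Sn _ 1)) !A_alpha_edge_form //.
apply: ler_sum => i _; apply: ler_sum => j _; apply: ler_wpM2r.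
  exact: edge_form_ge0.
by rewrite ler_nat; have := sub12 i j; case: (e1 i j) => // ->.
Qed.

(** Ky Fan's inequality with denominators cleared, so that it applies to vectors that are not
    normalised, such as integer ones. *)
Lemma S2_ge (R : realType) n (M : 'M[R]_n.+2) (x y : 'rV[R]_n.+2) c :
  M^T = M -> x != 0 -> y != 0 -> dotr x y = 0 ->
  c * (dotr x x * dotr y y)
    <= dotr (x *m M) x * dotr y y + dotr (y *m M) y * dotr x x ->
  c <= S2 M.
Proof.
move=> symM x0 y0 xy le_c.
have nrm (z : 'rV[R]_n.+2) : z != 0 ->
    exists2 a, a ^+ 2 * dotr z z = 1 & dotr (a *: z) (a *: z) = 1.
  rewrite -dotrr_gt0 => z0; exists (Num.sqrt (dotr z z))^-1; last first.
    by rewrite dotrZl dotrZr mulrA -expr2 exprVn sqr_sqrtr ?ltW // mulVf ?gt_eqF.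
  by rewrite exprVn sqr_sqrtr ?ltW // mulVf ?gt_eqF.
have [[a aE a1] [b bE b1]] := (nrm x x0, nrm y y0).
have := ky_fan2 symM a1 b1; rewrite dotrZl dotrZr xy !mulr0 => /(_ erefl).
apply: le_trans; rewrite -!scalemxAl !dotrZl !dotrZr.
have -> : c = a ^+ 2 * b ^+ 2 * (c * (dotr x x * dotr y y)).
  by rewrite mulrCA mulrACA aE bE !mulr1.
have := ler_wpM2l (mulr_ge0 (sqr_ge0 a) (sqr_ge0 b)) le_c.
move/le_trans; apply; rewrite le_eqVlt; apply/orP; left; apply/eqP.
rewrite mulrDr; congr (_ + _).
  by rewrite -[RHS]mulr1 -bE; ring.
by rewrite -[RHS]mulr1 -aE; ring.
Qed.

(** * Eigenvalues of the path *)

Lemma path_graph_sym n : symmetric (@path_graph n).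
Proof. by move=> i j; rewrite /path_graph orbC. Qed.

Lemma sum_ord_eq_le1 (R : realType) n k :
  \sum_(j < n) ((j : nat) == k)%:R <= 1 :> R.
Proof.
have [kn|nk] := ltnP k n.
  rewrite (bigD1 (Ordinal kn)) //= eqxx big1 ?addr0 // => j.
  by rewrite -val_eqE /= => /negPf ->.
by rewrite big1 ?ler01 // => j _; rewrite (ltn_eqF (leq_trans (ltn_ord j) nk)).
Qed.

(** The sharper bound at the single end [ord0] is what yields strictness in [path_form_lt]. *)
Lemma path_degree (R : realType) n (i : 'I_n.+1) :
  \sum_j (path_graph i j)%:R <= 2 - (i == ord0)%:R :> R.
Proof.
have : \sum_j (path_graph i j)%:R
    <= \sum_(j < n.+1) (j == i.+1 :> nat)%:R + \sum_(j < n.+1) (j.+1 == i)%:R :> R.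
  rewrite -big_split /=; apply: ler_sum => j _.
  rewrite /path_graph [i.+1 == _]eq_sym.
  by case: eqP => _; case: eqP => _ /=; rewrite ?lerDl ?lerDr ?ler01 ?addr0 ?add0r.
move/le_trans; apply; have le1 := sum_ord_eq_le1 R n.+1 i.+1.
case: (eqVneq i ord0) => [i0|i0] /=.
  have -> : \sum_(j < n.+1) (j.+1 == i)%:R = 0 :> R.
    by rewrite big1 // => j _; rewrite i0.
  by rewrite addr0; apply: le_trans le1 _; lra.
rewrite subr0 -[2]/(1 + 1); apply: lerD le1 _.
apply: le_trans (sum_ord_eq_le1 R n.+1 i.-1); apply: ler_sum => j _.
rewrite ler_nat; case: (@eqP _ j.+1) => // ji.
by rewrite -ji /= eqxx.
Qed.

(** Twice the form is [2 D - (1 - alpha) S], with [D] the degree form and [S] the sum of squared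
    differences over oriented edges. A Rayleigh quotient of at least 2 would force [x] to vanish at
    one end and to be constant along the path. *)
Lemma path_form_lt (R : realType) n (alpha : R) (x : 'rV[R]_n.+1) :
  alpha < 1 -> x != 0 ->
  dotr (x *m A_alpha alpha (@path_graph n.+1)) x < 2 * dotr x x.
Proof.
move=> alpha1 /eqP x_neq0; rewrite ltNge; apply/negP => form_ge; apply: x_neq0.
pose S : R := \sum_(i < n.+1) \sum_j (path_graph i j)%:R * (x 0 i - x 0 j) ^+ 2.
pose D : R := \sum_(i < n.+1) \sum_j (path_graph i j)%:R * x 0 i ^+ 2.
have D2 : D = \sum_(i < n.+1) \sum_j (path_graph i j)%:R * x 0 j ^+ 2.
  rewrite /D exchange_big; apply: eq_bigr => i _; apply: eq_bigr => j _.
  by rewrite path_graph_sym.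
have formE : 2 * dotr (x *m A_alpha alpha (@path_graph n.+1)) x
    = 2 * D - (1 - alpha) * S.
  rewrite A_alpha_edge_form; last exact: path_graph_sym.
  have -> : 2 * D = D + D by ring.
  rewrite {2}D2 /D /S.
  rewrite mulr_sumr -sumrN -!big_split; apply: eq_bigr => i _ /=.
  rewrite mulr_sumr -sumrN -!big_split; apply: eq_bigr => j _ /=.
  by rewrite /edge_form; ring.
have D_le : D <= 2 * dotr x x - x 0 0 ^+ 2.
  have -> : x 0 0 ^+ 2 = \sum_i (i == ord0)%:R * x 0 i ^+ 2.
    rewrite (bigD1 ord0) //= mul1r big1 ?addr0 // => j /negPf j0.
    by rewrite j0 mul0r.
  rewrite dotrE mulr_sumr -sumrB; apply: ler_sum => i _.
  rewrite -mulr_suml -expr2 -mulrBl.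
  by apply: ler_wpM2r; rewrite ?sqr_ge0 // path_degree.
have S_ge0 : 0 <= S.
  by apply: sumr_ge0 => i _; apply: sumr_ge0 => j _; rewrite mulr_ge0 ?sqr_ge0.
have x0_ge0 := sqr_ge0 (x 0 0).
have aS_ge0 : 0 <= (1 - alpha) * S by rewrite mulr_ge0 // subr_ge0 ltW.
(* The bounds combine to [2 x_0^2 + (1 - alpha) S <= 0], so both terms vanish. *)
have x00 : x 0 0 = 0 by apply/eqP; rewrite -sqrf_eq0 eq_le x0_ge0 andbT; lra.
have S0 : S = 0.
  have : (1 - alpha) * S == 0 by rewrite eq_le aS_ge0 andbT; lra.
  by rewrite mulf_eq0 subr_eq0 gt_eqF // => /eqP.
have x_edge i j : path_graph i j -> x 0 i = x 0 j.
  move=> ij; apply/eqP; rewrite -subr_eq0 -sqrf_eq0; apply/eqP.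
  have S_ij k : 0 <= \sum_j (path_graph k j)%:R * (x 0 k - x 0 j) ^+ 2.
    by apply: sumr_ge0 => l _; rewrite mulr_ge0 ?sqr_ge0.
  have S_i : \sum_l (path_graph i l)%:R * (x 0 i - x 0 l) ^+ 2 = 0.
    by apply: (psumr_eq0P _ S0).
  have : (path_graph i j)%:R * (x 0 i - x 0 j) ^+ 2 = 0.
    by apply: (psumr_eq0P _ S_i) => // l _; rewrite mulr_ge0 ?sqr_ge0.
  by rewrite ij mul1r.
apply/rowP => -[k kn]; rewrite mxE.
elim: k kn => [|k IH] kn; first by rewrite -[RHS]x00; congr (x _ _); apply: val_inj.
by rewrite -[RHS](IH (ltnW kn)); apply: x_edge; rewrite /path_graph /= eqxx orbT.
Qed.

Lemma eigs_path_lt2 (R : realType) n (alpha : R) i : alpha < 1 -> (i < n.+2)%N ->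
  (eigs (A_alpha alpha (@path_graph n.+2)))`_i < 2.
Proof.
move=> alpha1 /eigs_eigenvector ev.
have [v vM v0] := ev _ _ (A_alpha_sym alpha (@path_graph_sym n.+2)).
have := path_form_lt alpha1 v0; rewrite vM dotrZl ltr_pM2r // dotrr_gt0 //.
Qed.

(** * Graphs with a vertex of degree at least 3 *)

(* A rooted tree on [0 .. size p] is coded by the list [p] of parents, [p`_i]
   being the parent of the vertex [i.+1]. *)
Section TreeCertificate.
Implicit Types (p : seq nat) (x y : seq Z).

(** A plain [foldr] over [Z], so that certificates can be evaluated by [vm_compute]. *)
Definition sumZ (s : seq Z) : Z := foldr +%R 0 s.

Definition tree_sum (g : Z -> Z -> Z) p x :=
  sumZ (mkseq (fun i => g x`_i.+1 x`_(nth 0%N p i)) (size p)).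

Definition dotZ k x y := sumZ (mkseq (fun i => x`_i * y`_i) k).

(** Ky Fan's condition on the tree, cleared of denominators: on the span of [x] and [y] the degree
    matrix has trace at least 4 and the signless Laplacian trace at least 8. Neither requirement
    involves [alpha]. *)
Definition certifies p x y :=
  let k := (size p).+1 in
  let xx := dotZ k x x in
  let yy := dotZ k y y in
  let deg := tree_sum (fun a b => a * a + b * b) p in
  let signless := tree_sum (fun a b => (a + b) * (a + b)) p in
  [&& 0 < xx, 0 < yy, dotZ k x y == 0,
      4 * (xx * yy) <= deg x * yy + deg y * xx
    & 8 * (xx * yy) <= signless x * yy + signless y * xx].

Definition add_nth i (c : Z) x := set_nth 0 x i (x`_i + c).

(** One product with [Q - 1]: the accumulator starts at [-x], and each tree edge adds the sum of its
    end values at both of its ends. *)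
Definition power_step p x :=
  foldr (fun i y => let c := x`_i.+1 + x`_(nth 0%N p i) in
                    add_nth i.+1 c (add_nth (nth 0%N p i) c y))
        (map -%R x) (iota 0 (size p)).

(* Approximations of the two leading eigenvectors of the signless Laplacian [Q]
   by power iteration with [Q - 1]; nothing about them needs to be proved, as
   [certifies] checks all that is needed. *)
Definition heavy p :=
  let k := (size p).+1 in
  let x := take k (iter 6 (power_step p) (nseq k 1)) in
  let z := iter 6 (power_step p) (nseq k.-2 0 ++ [:: -1; 2]) in
  let xx := dotZ k x x in
  let xz := dotZ k x z in
  certifies p x (mkseq (fun i => xx * z`_i - xz * x`_i) k).

(* Parents occur in non-decreasing order: trees are grown breadth first. *)
Fixpoint grows_heavy fuel p :=
  if heavy p then true else
  if fuel is fuel'.+1 then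
    all (fun u => grows_heavy fuel' (rcons p u))
        (iota (last 0%N p) ((size p).+1 - last 0%N p))
  else false.

(** The claw has 4 vertices, so fuel 8 admits trees with up to 12 vertices; the hypothesis [12 <= n]
    leaves room for all of them. *)
Lemma claw_grows_heavy : grows_heavy 8 [:: 0; 0; 0]%N.
Proof. by vm_compute. Qed.

End TreeCertificate.

(** * Transfer of integer certificates to the graph *)

Lemma sumZ_mkseq f k : sumZ (mkseq f k) = \sum_(i < k) f i.
Proof.
have -> (s : seq Z) : sumZ s = \sum_(z <- s) z.
  by elim: s => [|z s IH]; rewrite ?big_nil // big_cons -IH.
by rewrite big_map -{1}[k]subn0 -/(index_iota 0 k) big_mkord.
Qed.

Lemma int_of_Z_le a b : (int_of_Z a <= int_of_Z b) = (a <= b).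
Proof. by lia. Qed.

Lemma int_of_Z_lt a b : (int_of_Z a < int_of_Z b) = (a < b).
Proof. by lia. Qed.

(** Every element outside [s] has index [size s], where [F] vanishes; on [s] the index is a
    bijection onto the positions. *)
Lemma sum_index (R : nmodType) (T : finType) (s : seq T) (F : nat -> R) :
  uniq s -> F (size s) = 0 ->
  \sum_v F (index v s) = \sum_(i < size s) F i.
Proof.
move=> uniq_s F0; rewrite (bigID (mem s)) /= [X in _ + X]big1 ?addr0; last first.
  by move=> v /memNindex ->.
case: s uniq_s F0 => [|v0 s'] uniq_s F0.
  by rewrite big_ord0 big_pred0.
rewrite -big_uniq // (big_nth v0) big_mkord.
by apply: eq_bigr => i _; rewrite index_uniq.
Qed.

Section TreeTransfer.
Variables (R : realType) (n : nat) (alpha : R) (e : rel 'I_n.+2).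
Hypotheses (sym_e : symmetric e) (alpha_ge : 1 / 2 <= alpha) (alpha_lt1 : alpha < 1).
Variables (p : seq nat) (s : seq 'I_n.+2).
Hypotheses (uniq_s : uniq s) (size_s : size s = (size p).+1).
Hypothesis edge_s : forall i, (i < size p)%N ->
  (nth 0%N p i <= i)%N && e (nth ord0 s i.+1) (nth ord0 s (nth 0%N p i)).

Let ZR : Z -> R := intr \o int_of_Z.
HB.instance Definition _ := GRing.RMorphism.on ZR.

Let ZR_le a b : (ZR a <= ZR b) = (a <= b).
Proof. by rewrite /ZR /= ler_int int_of_Z_le. Qed.

Let ZR_lt a b : (ZR a < ZR b) = (a < b).
Proof. by rewrite /ZR /= ltr_int int_of_Z_lt. Qed.

(** Extension by zero: a vertex outside [s] has index [size s], which lies beyond the end of [x]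
    whenever [size x <= size s], so [nth] returns its default 0. *)
Definition transfer (x : seq Z) : 'rV[R]_n.+2 := \row_v ZR x`_(index v s).

Lemma transfer_dotr x y : (size x <= size s)%N ->
  dotr (transfer x) (transfer y) = ZR (dotZ (size p).+1 x y).
Proof.
move=> size_x; rewrite dotrE.
under eq_bigr do rewrite !mxE -rmorphM.
rewrite (@sum_index _ _ s (fun i => ZR (x`_i * y`_i))) //; last first.
  by rewrite nth_default // mul0r rmorph0.
by rewrite /dotZ sumZ_mkseq rmorph_sum size_s.
Qed.

(** Each tree edge occurs in both orientations among the adjacent pairs of the graph, and all other
    pairs contribute nonnegative terms. *)
Lemma sum_tree_edges (T : nat -> nat -> R) :
  (forall i j, 0 <= T i j) -> (forall i j, T i j = T j i) ->
  2 * (\sum_(i < size p) T i.+1 (nth 0%N p i))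
  <= \sum_u \sum_v (e u v)%:R * T (index u s) (index v s).
Proof.
move=> T_ge0 T_sym; pose k := (size p).+1.
have eT_ge0 u v i j : 0 <= (e u v)%:R * T i j by rewrite mulr_ge0.
pose c i j := e (nth ord0 s i) (nth ord0 s j).
pose tree i j := (0 < i)%N && (nth 0%N p i.-1 == j).
have le_index : \sum_(i < k) \sum_(j < k) (c i j)%:R * T i j
    <= \sum_u \sum_v (e u v)%:R * T (index u s) (index v s).
  (* Both functions are cut off at [k = size s], the index of vertices outside [s], as [sum_index]
     requires. *)
  pose G i j := if (j < k)%N then (c i j)%:R * T i j else 0.
  pose F i := if (i < k)%N then \sum_(j < k) (c i j)%:R * T i j else 0.
  have -> : \sum_(i < k) \sum_(j < k) (c i j)%:R * T i j = \sum_u F (index u s).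
    rewrite sum_index // /F size_s ?ltnn //.
    by apply: eq_bigr => i _; rewrite ltn_ord.
  apply: ler_sum => u _; rewrite /F; case: ifP => [u_in|_]; last exact: sumr_ge0.
  have -> : \sum_(j < k) (c (index u s) j)%:R * T (index u s) j
      = \sum_v G (index u s) (index v s).
    rewrite sum_index // /G size_s ?ltnn //.
    by apply: eq_bigr => j _; rewrite ltn_ord.
  apply: ler_sum => v _; rewrite /G; case: ifP => [v_in|_]; last exact: eT_ge0.
  by rewrite /c !nth_index // -index_mem size_s.
apply: le_trans le_index.
have sum_tree : \sum_(i < k) \sum_(j < k) (tree i j)%:R * T i j
    = \sum_(i < size p) T i.+1 (nth 0%N p i).
  rewrite big_ord_recl big1 ?add0r => [|j _]; last by rewrite mul0r.
  apply: eq_bigr => i _; have /andP[p_le _] := edge_s (ltn_ord i).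
  have p_lt : (nth 0%N p i < k)%N by rewrite ltnS (leq_trans p_le) // ltnW.
  rewrite (bigD1 (Ordinal p_lt)) //= big1 => [|j j_neq].
    by rewrite /tree /= eqxx mul1r addr0.
  by rewrite /tree /= eq_sym -val_eqE /= in j_neq *; rewrite (negPf j_neq) mul0r.
have -> : 2 * (\sum_(i < size p) T i.+1 (nth 0%N p i))
    = \sum_(i < k) \sum_(j < k) ((tree i j)%:R + (tree j i)%:R) * T i j.
  rewrite mulr_natl mulr2n -{1}sum_tree -sum_tree [X in _ + X]exchange_big -big_split.
  apply: eq_bigr => i _; rewrite -big_split; apply: eq_bigr => j _ /=.
  by rewrite mulrDl (T_sym j i).
apply: ler_sum => i _; apply: ler_sum => j _; apply: ler_wpM2r => //.
have tree_edge a b : tree a b -> (a < k)%N -> (b < a)%N && c a b.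
  case: a => [//|a] /eqP <- /= a_lt; have /andP[p_le eab] := edge_s a_lt.
  by rewrite ltnS p_le.
have c_sym : c j i = c i j by rewrite /c sym_e.
have := @tree_edge i j; have := @tree_edge j i; rewrite !ltn_ord c_sym.
(* A parent precedes its child, so [tree i j] and [tree j i] cannot both hold and the coefficient
   never exceeds 1. *)
case: (tree i j); case: (tree j i) => /=; rewrite ?addr0 ?add0r ?ler0n //.
- move=> /(_ isT isT) /andP[ji _] /(_ isT isT) /andP[ij _].
  by have := ltn_trans ji ij; rewrite ltnn.
- by move=> _ /(_ isT isT) /andP[_ ->].
- by move=> /(_ isT isT) /andP[_ ->].
Qed.

Lemma transfer_form x : (size x <= size s)%N ->
  (2 * alpha - 1) * ZR (tree_sum (fun a b => a * a + b * b) p x)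
    + (1 - alpha) * ZR (tree_sum (fun a b => (a + b) * (a + b)) p x)
  <= dotr (transfer x *m A_alpha alpha e) (transfer x).
Proof.
move=> size_x; rewrite -(ler_pM2l (ltr0Sn _ 1)) A_alpha_edge_form //.
pose T i j := edge_form alpha (ZR x`_i) (ZR x`_j).
have T_ge0 i j : 0 <= T i j by apply: edge_form_ge0.
have T_sym i j : T i j = T j i by rewrite /T /edge_form; ring.
under eq_bigr do under eq_bigr do rewrite !mxE.
apply: le_trans (sum_tree_edges T_ge0 T_sym).
apply: ler_wpM2l => //; rewrite /tree_sum !sumZ_mkseq !rmorph_sum /=.
rewrite !mulr_sumr -big_split le_eqVlt.
apply/orP; left; apply/eqP; apply: eq_bigr => i _ /=.
by rewrite /T /edge_form !(rmorphD, rmorphM) /=; ring.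
Qed.

Lemma certifies_S2 x y : (size x <= size s)%N -> (size y <= size s)%N ->
  certifies p x y -> 4 <= S2 (A_alpha alpha e).
Proof.
move=> size_x size_y; rewrite /certifies; cbv zeta beta.
have le_x := transfer_form size_x; have le_y := transfer_form size_y.
move: (tree_sum _ p x) (tree_sum _ p x) (tree_sum _ p y) (tree_sum _ p y) le_x le_y.
move=> signless_x deg_x signless_y deg_y le_x le_y.
have := transfer_dotr x size_x; have := transfer_dotr y size_y.
have := transfer_dotr y size_x.
move: (dotZ _ x x) (dotZ _ y y) (dotZ _ x y) => xx yy xy xyE yyE xxE.
have ZR_scale k : ZR (k%:R * (xx * yy)) = k%:R * (ZR xx * ZR yy).
  by rewrite rmorphM rmorph_nat rmorphM.
have ZR_comb a b : ZR (a * yy + b * xx) = ZR a * ZR yy + ZR b * ZR xx.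
  by rewrite rmorphD !rmorphM.
case/and5P; rewrite -!ZR_lt -!ZR_le rmorph0 !ZR_scale !ZR_comb.
rewrite -xxE -yyE !dotrr_gt0 => x0 y0 /eqP xy0 deg_le signless_le.
apply: (@S2_ge _ _ _ (transfer x) (transfer y)) => //.
- exact: A_alpha_sym.
- by rewrite xyE xy0 rmorph0.
move: x0 y0; rewrite -!dotrr_gt0 => /ltW x_ge0 /ltW y_ge0.
apply: le_trans (lerD (ler_wpM2r y_ge0 le_x) (ler_wpM2r x_ge0 le_y)).
have a1 : 0 <= 2 * alpha - 1 by move: alpha_ge; lra.
have a2 : 0 <= 1 - alpha by rewrite subr_ge0 ltW.
(* The constants match for every [alpha]: [4 (2 alpha - 1) + 8 (1 - alpha) = 4]. *)
have := lerD (ler_wpM2l a1 deg_le) (ler_wpM2l a2 signless_le).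
lra.
Qed.

End TreeTransfer.

(** * Breadth-first growth of subtrees *)

Section Growth.
Variables (n : nat) (e : rel 'I_n.+2).
Hypotheses (sym_e : symmetric e) (conn_e : graph_connected e).
Implicit Types (p : seq nat) (s : seq 'I_n.+2).

Lemma edge_leaving s : s != [::] -> (size s < n.+2)%N ->
  exists u v, [/\ u \in s, v \notin s & e u v].
Proof.
move=> s_n0 size_s.
suff /existsP[u /existsP[v /and3P[us vs uv]]] :
    [exists u, exists v, [&& u \in s, v \notin s & e u v]] by exists u, v.
have [v0 v0s] : exists v, v \notin s.
  apply/existsP; rewrite -negb_forall; apply/negP => /forallP s_all.
  have : (#|'I_n.+2| <= size s)%N.
    apply: leq_trans (card_size s); apply: subset_leq_card.
    by apply/subsetP => v _; apply: s_all.
  by rewrite card_ord leqNgt size_s.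
case: s s_n0 size_s v0s => // u0 s _ _ v0s; set t := u0 :: s in v0s *.
apply: contraNT v0s => /existsPn no_edge.
have closed_t : closed e (mem t).
  apply: intro_closed; first exact: sym_connect_sym.
  move=> u v uv u_t; apply: contraT => v_t.
  by have /existsPn/(_ v) := no_edge u; rewrite u_t v_t uv.
by rewrite -(closed_connect closed_t (conn_e u0 v0)) /= mem_head.
Qed.

(* [s] lists the vertices of a tree of [e] coded by [p], in breadth-first order:
   the vertices preceding the last parent have all their neighbours in [s]. *)
Definition bfs_tree p s :=
  [/\ uniq s, size s = (size p).+1,
      forall i, (i < size p)%N ->
        (nth 0%N p i <= i)%N && e (nth ord0 s i.+1) (nth ord0 s (nth 0%N p i))
    & forall i v, (i < last 0%N p)%N -> e (nth ord0 s i) v -> v \in s].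

(** The new parent [u] is the least position with a neighbour outside [s]. Minimality keeps the
    closure condition, and the old closure condition puts [u] in exactly the range that
    [grows_heavy] enumerates. *)
Lemma bfs_tree_grow p s : bfs_tree p s -> (size s < n.+2)%N ->
  exists u v, (last 0%N p <= u <= size p)%N /\ bfs_tree (rcons p u) (rcons s v).
Proof.
move=> [uniq_s size_s edge_s closed_s] size_lt.
pose P i := (i < size s)%N && [exists v, (v \notin s) && e (nth ord0 s i) v].
have exP : exists i, P i.
  have [|u [v [us vs uv]]] := edge_leaving _ size_lt; first by rewrite -size_eq0 size_s.
  exists (index u s); rewrite /P index_mem us; apply/existsP; exists v.
  by rewrite vs nth_index.
case: (ex_minnP exP) => u /andP[u_lt /existsP[v /andP[vs uv]]] u_min.
exists u, v; split.
  apply/andP; split; last by rewrite -ltnS -size_s.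
  rewrite leqNgt; apply/negP => u_last.
  by rewrite (closed_s u v u_last uv) in vs.
split.
- by rewrite rcons_uniq vs.
- by rewrite !size_rcons size_s.
- move=> i; rewrite size_rcons ltnS leq_eqVlt => /orP[/eqP -> | i_lt].
    rewrite nth_rcons ltnn eqxx !nth_rcons size_s ltnn eqxx -size_s u_lt sym_e uv.
    by rewrite -ltnS -size_s u_lt.
  have /andP[p_le e_i] := edge_s i i_lt.
  rewrite nth_rcons i_lt p_le !nth_rcons size_s ltnS i_lt.
  by rewrite ltnS (leq_trans p_le (ltnW i_lt)).
- move=> i w; rewrite last_rcons => i_lt; have i_s := ltn_trans i_lt u_lt.
  rewrite nth_rcons i_s => iw; rewrite mem_rcons inE; apply/orP; right.
  apply: contraLR i_lt => ws; rewrite -leqNgt; apply: u_min.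
  by rewrite /P i_s; apply/existsP; exists w; rewrite ws.
Qed.

(** The graph selects one branch of the exhaustive search: while fuel remains, [s] misses a vertex
    and can grow, and every branch of the search ends in a heavy tree. *)
Lemma grows_heavy_bfs fuel p s :
  grows_heavy fuel p -> bfs_tree p s -> (size s + fuel <= n.+2)%N ->
  exists p' s', bfs_tree p' s' /\ heavy p'.
Proof.
elim: fuel p s => [|fuel IH] p s /=; case: ifP => // heavy_p; try by exists p, s.
move=> /allP grow tree_s size_le.
have size_lt : (size s < n.+2)%N by lia.
have [u [v [u_le tree_sv]]] := bfs_tree_grow tree_s size_lt.
apply: (IH (rcons p u) (rcons s v)) => //; last by rewrite size_rcons addSnnS.
by apply: grow; rewrite mem_iota; lia.
Qed.

Lemma bfs_tree_claw v : (2 < #|[set w | e v w]|)%N -> irreflexive e ->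
  exists s, size s = 4 /\ bfs_tree [:: 0; 0; 0]%N s.
Proof.
move=> /card_gt2P[a [b [c [[]]]]]; rewrite !inE => va vb vc [ab bc ca] irr.
have neq w : e v w -> v != w by apply: contraTneq => <-; rewrite irr.
(* The closure condition is vacuous, since the last parent is the root at position 0. *)
exists [:: v; a; b; c]; split=> //; split=> //.
- by rewrite /= !inE !negb_or !neq // ab bc (eq_sym a c) ca.
- by case=> [|[|[|//]]] _ /=; rewrite sym_e.
Qed.

Theorem S2_ge4_of_degree3 (R : realType) (alpha : R) v :
  (12 <= n.+2)%N -> irreflexive e -> 1 / 2 <= alpha -> alpha < 1 ->
  (2 < #|[set w | e v w]|)%N -> 4 <= S2 (A_alpha alpha e).
Proof.
move=> n_ge irr_e alpha_ge alpha_lt /bfs_tree_claw/(_ irr_e)[s0 [size_s0 tree0]].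
have [|p [s [[uniq_s size_s edge_s _] heavy_p]]] :=
  grows_heavy_bfs claw_grows_heavy tree0; first by rewrite size_s0.
(* The length bounds come from [take] and [mkseq] in [heavy], whose second vector is a Gram-Schmidt
   step scaled by [xx] to stay integral. *)
apply: (certifies_S2 sym_e alpha_ge alpha_lt uniq_s size_s edge_s) heavy_p.
  by rewrite size_take size_s; case: ltnP => //; lia.
by rewrite size_mkseq size_s.
Qed.

End Growth.

(** * Graphs with a Hamiltonian path *)

(** A path missing some vertex has an edge leaving it. If that edge starts at an end, the path is
    extended there; at an inner vertex it would be a third edge besides the two path edges. *)
Lemma hamiltonian_path n (e : rel 'I_n.+2) :
  simple_graph e -> graph_connected e ->
  (forall v, #|[set w | e v w]| <= 2)%N ->
  exists s, [/\ uniq s, sorted e s & size s = n.+2].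
Proof.
move=> [sym_e irr_e] conn_e deg_le2.
have no_claw u a b c : uniq [:: a; b; c] -> e u a -> e u b -> e u c -> False.
  move=> uniq_abc ua ub uc; have := deg_le2 u; rewrite leqNgt => /negP; apply.
  apply: leq_trans (_ : #|[set x in [:: a; b; c]]| <= _)%N.
    by rewrite cardsE (card_uniqP uniq_abc).
  by apply: subset_leq_card; apply/subsetP => x; rewrite !inE => /or3P[] /eqP ->.
suff main m : (m < n.+2)%N -> exists s, [/\ uniq s, sorted e s & size s = m.+1].
  exact: main.
elim: m => [_|m IH m_lt]; first by exists [:: ord0].
have [s [uniq_s sorted_s size_s]] := IH (ltnW m_lt).
have [| |u [v [us vs uv]]] := @edge_leaving _ e sym_e conn_e s; rewrite ?size_s //.
  by rewrite -size_eq0 size_s.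
case: s size_s uniq_s sorted_s us vs => // x t [size_t] uniq_s path_t us vs.
have uniq_v : uniq (v :: x :: t) by rewrite cons_uniq vs.
have [ux|ux] := eqVneq u x.
  exists [:: v, x & t]; split=> //; last by rewrite -size_t.
  by rewrite /= sym_e -{1}ux uv.
have [ul|ul] := eqVneq u (last x t).
  exists (rcons (x :: t) v); split; last by rewrite size_rcons -size_t.
    by rewrite rcons_uniq vs.
  by rewrite /= rcons_path -ul uv andbT.
move: us; rewrite inE (negPf ux) /= => u_t.
rewrite /= in path_t; case/splitPr: u_t uniq_v path_t ul => p1 [|y p2].
  by rewrite last_cat /= eqxx.
rewrite cat_path => uniq_v /= /and4P[_ pu uy _] _; exfalso.
apply: (@no_claw u v (last x p1) y) => //; last by rewrite sym_e.
(* The three neighbours of [u] form a subsequence of the duplicate-free list [v :: s], hence are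
   distinct. *)
apply: (subseq_uniq _ uniq_v).
change (subseq ([:: v] ++ [:: last x p1] ++ [:: y])
  ([:: v] ++ (x :: p1) ++ u :: y :: p2)).
by rewrite !cat_subseq // sub1seq ?mem_last // !inE eqxx orbT.
Qed.

(** * Relabelling and comparison with the path *)

Lemma A_alpha_perm (R : realType) n (alpha : R) (e1 e2 : rel 'I_n) (f : {perm 'I_n}) :
  (forall x y, e1 x y = e2 (f x) (f y)) ->
  A_alpha alpha e1 = perm_mx f *m A_alpha alpha e2 *m (perm_mx f)^T.
Proof.
move=> ef; rewrite tr_perm_mx -row_permE -col_permE.
apply/matrixP => i j; rewrite !mxE ef (inj_eq perm_inj); congr (_ * (_ * _%:R) + _).
rewrite -[RHS](card_preimset _ (@perm_inj _ f)); apply: eq_card => k.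
by rewrite !inE ef.
Qed.

(** [is_eig_list] sees the matrix only through its characteristic polynomial, so after rewriting
    both sides make literally the same [epsilon] choice. *)
Lemma S2_graph_iso (R : realType) n (alpha : R) (e1 e2 : rel 'I_n) :
  graph_iso e1 e2 -> S2 (A_alpha alpha e1) = S2 (A_alpha alpha e2).
Proof.
move=> [f /A_alpha_perm ->]; rewrite /S2 /eigs /is_eig_list char_poly_conj //.
by rewrite tr_perm_mx -perm_mxM mulVg perm_mx1.
Qed.

Lemma sum_path_graph (R : realType) n :
  2 * n%:R <= \sum_(i < n.+1) \sum_j (path_graph i j)%:R :> R.
Proof.
have -> : 2 * n%:R = \sum_(i < n.+1) \sum_(j < n.+1) (i.+1 == j)%:R
    + \sum_(i < n.+1) \sum_(j < n.+1) (j.+1 == i)%:R :> R.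
  rewrite [X in _ + X]exchange_big -mulr2n -[RHS]mulr_natl; congr (_ * _).
  rewrite big_ord_recr /= [X in _ + X]big1 ?addr0 => [|j _]; last first.
    by rewrite gtn_eqF.
  rewrite -[LHS]mulr1 mulr_natl -[in LHS](card_ord n) -sumr_const.
  apply: eq_bigr => i _; rewrite (bigD1 (lift ord0 i)) //= /bump leq0n add1n eqxx.
  rewrite big1 ?addr0 // => j; rewrite -val_eqE /= /bump leq0n add1n eq_sym.
  by move=> /negPf ->.
rewrite -big_split; apply: ler_sum => i _; rewrite -big_split; apply: ler_sum => j _ /=.
rewrite /path_graph; case: (i.+1 =P j) => [ij|_]; case: (j.+1 =P i) => [ji|_] //=.
- by exfalso; lia.
- by rewrite addr0.
- by rewrite add0r.
- by rewrite addr0.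
Qed.

Lemma S2_path_lt (R : realType) n (alpha : R) (e : rel 'I_n.+2) a b :
  simple_graph e -> 1 / 2 <= alpha -> alpha < 1 ->
  subrel (@path_graph n.+2) e -> e a b -> ~~ path_graph a b ->
  S2 (A_alpha alpha (@path_graph n.+2)) < S2 (A_alpha alpha e).
Proof.
move=> [sym_e irr_e] alpha_ge alpha_lt sub_e ab path_ab.
have symP := @path_graph_sym n.+2; pose one : 'rV[R]_n.+2 := const_mx 1.
have one1 : dotr one one = n.+2%:R.
  rewrite dotrE; under eq_bigr do rewrite !mxE mulr1.
  by rewrite sumr_const card_ord.
have form1 : 2 * dotr one one <= dotr (one *m A_alpha alpha e) one.
  rewrite A_alpha_form.
  (* On the all-ones vector each oriented edge weighs [alpha + (1 - alpha) = 1], so the form is the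
     degree sum: at least [2 n.+1] from the path, plus 2 from the extra edge. *)
  under eq_bigr do under eq_bigr do rewrite !mxE expr1n !mulr1 subrKC mulr1.
  have -> : 2 * dotr one one = 2 * n.+1%:R + 2 by rewrite one1 -[n.+2]addn1 natrD; ring.
  have sum_delta (x y : 'I_n.+2) : \sum_i \sum_j (i == x)%:R * (j == y)%:R = 1 :> R.
    rewrite (bigD1 x) //= (bigD1 y) //= !eqxx mulr1 !big1 ?addr0 //.
      by move=> i /negPf ix; rewrite big1 // => j _; rewrite ix mul0r.
    by move=> j /negPf ->; rewrite mulr0.
  apply: le_trans (lerD (sum_path_graph R n.+1) (lexx 2)) _.
  have two : 2 = \sum_(i < n.+2) \sum_(j < n.+2) (i == a)%:R * (j == b)%:R
      + \sum_(i < n.+2) \sum_(j < n.+2) (i == b)%:R * (j == a)%:R :> R.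
    by rewrite !sum_delta; ring.
  rewrite [X in _ + X <= _]two -!big_split /=.
  apply: ler_sum => i _; rewrite -!big_split /=; apply: ler_sum => j _.
  have ab_neq : a != b by apply: contraTneq ab => ->; rewrite irr_e.
  have ba : e b a by rewrite sym_e.
  have path_ba : ~~ path_graph b a by rewrite symP.
  rewrite -!natrM !mulnb -!natrD ler_nat.
  have [/andP[/eqP -> /eqP ->]|_] := boolP ((i == a) && (j == b)).
    by rewrite ab (negPf path_ab) (negPf ab_neq).
  have [/andP[/eqP -> /eqP ->]|_] := boolP ((i == b) && (j == a)).
    by rewrite ba (negPf path_ba).
  by rewrite !addn0; have := sub_e i j; case: (path_graph i j) => // ->.
have one0 : one != 0 by rewrite -dotrr_gt0 one1 ltr0n.
have [u [u0 u_one] u_ge] :=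
  courant_fischer2 (A_alpha_sym alpha symP) one.
have lam1 := @eigs_path_lt2 R n alpha 0 alpha_lt isT.
(* Strictness arises here, from the leading eigenvalue of the path being below 2. *)
apply: lt_le_trans (_ : 2 + (eigs (A_alpha alpha (@path_graph n.+2)))`_1 <= _).
  by rewrite /S2 ltrD2r.
apply: (S2_ge (A_alpha_sym alpha sym_e) one0 u0); first by rewrite dotrC.
have form_u := le_trans u_ge (A_alpha_form_mono u alpha_ge alpha_lt symP sym_e sub_e).
have uu : 0 <= dotr u u by rewrite ltW // dotrr_gt0.
have oo : 0 <= dotr one one by rewrite ltW // dotrr_gt0.
have := lerD (ler_wpM2r uu form1) (ler_wpM2r oo form_u); lra.
Qed.

Lemma S2_path_min (R : realType) n (alpha : R) (e : rel 'I_n) :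
  (12 <= n)%N -> simple_graph e -> graph_connected e ->
  1 / 2 <= alpha -> alpha < 1 -> ~ graph_iso e (@path_graph n) ->
  S2 (A_alpha alpha (@path_graph n)) < S2 (A_alpha alpha e).
Proof.
case: n e => [|[|n]] // e n_ge simple_e conn_e alpha_ge alpha_lt not_iso.
have [sym_e irr_e] := simple_e.
have [/existsP[v deg_v]|] := boolP [exists v, 2 < #|[set w | e v w]|]%N.
  apply: lt_le_trans (S2_ge4_of_degree3 sym_e conn_e n_ge irr_e alpha_ge alpha_lt deg_v).
  have := @eigs_path_lt2 R n alpha 0 alpha_lt isT.
  by have := @eigs_path_lt2 R n alpha 1 alpha_lt isT; rewrite /S2; lra.
rewrite negb_exists => /forallP deg_le2.
have [v|s [uniq_s path_s size_s]] := hamiltonian_path simple_e conn_e.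
  by rewrite leqNgt deg_le2.
have inj_s : injective (fun i : 'I_n.+2 => nth ord0 s i).
  by move=> i j /eqP; rewrite nth_uniq ?size_s // => /eqP/val_inj.
(* Relabelling by position on the Hamiltonian path makes [path_graph] a subgraph of [e1]. *)
pose f := perm inj_s; pose e1 : rel 'I_n.+2 := fun i j => e (f i) (f j).
have iso_e : graph_iso e e1.
  by exists f^-1%g => x y; rewrite /e1 !permKV.
have simple_e1 : simple_graph e1.
  by split=> [i j|i]; [exact: sym_e | exact: irr_e].
have sub_e1 : subrel (@path_graph n.+2) e1.
  have edge_s (i j : 'I_n.+2) : i.+1 = j -> e (f i) (f j).
    move=> ij; rewrite !permE -ij.
    by apply: (elimT (sortedP ord0) path_s); rewrite size_s ij.
  by move=> i j /orP[] /eqP /edge_s; rewrite // /e1 sym_e.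
rewrite (S2_graph_iso alpha iso_e).
have [/existsP[a /existsP[b /andP[ab path_ab]]]|] :=
  boolP [exists a, exists b, e1 a b && ~~ path_graph a b].
  exact: S2_path_lt simple_e1 alpha_ge alpha_lt sub_e1 ab path_ab.
(* Without an edge outside the path, [e1] is the path itself, so [e] is isomorphic to it. *)
move=> /existsPn no_ab; case: not_iso; exists f^-1%g => x y.
apply/idP/idP => [xy|/sub_e1]; last by rewrite /e1 !permKV.
have /existsPn/(_ ((f^-1)%g y)) := no_ab ((f^-1)%g x).
by rewrite /e1 !permKV xy /= negbK.
Qed.

Theorem theorem5p5 (R : realType) (n : nat) (e : rel 'I_n) (alpha : R) :
  (12 <= n)%N -> simple_graph e -> graph_connected e ->
  1 / 2 <= alpha -> alpha < 1 ->
  S2 (A_alpha alpha (@path_graph n)) <= S2 (A_alpha alpha e) /\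
  (S2 (A_alpha alpha e) = S2 (A_alpha alpha (@path_graph n)) <-> graph_iso e (@path_graph n)).
Proof.
move=> n_ge simple_e conn_e alpha_ge alpha_lt.
(* The strict inequality for graphs not isomorphic to the path gives both the bound and the equality
   case. *)
have [iso_e|not_iso] := classic (graph_iso e (@path_graph n)).
  by rewrite (S2_graph_iso alpha iso_e).
have lt_e := S2_path_min n_ge simple_e conn_e alpha_ge alpha_lt not_iso.
split; first exact: ltW.
split=> [eq_e|iso_e]; last by case: not_iso.
by move: lt_e; rewrite eq_e ltxx.
Qed.
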